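(* Let $A$ be an approximately semi-contractible Banach algebra and $\Theta:A\to B$ a continuous surjective homomorphism onto a Banach algebra $B$. Then $B$ is approximately semi-contractible. If $A$ is boundedly approximately semi-contractible then so is $B$; if, further, $\Theta$ is the quotient map $A\to A/I$ determined by a closed two-sided ideal $I$ of $A$, then $K_{BASC}(B)\le K_{BASC}(A)$. Likewise, if $A$ is boundedly approximately semi-amenable then so is $B$.
   Context: For a Banach algebra $C$ and Banach $C$-bimodule $Y$, a derivation is a linear $D:C\to Y$ with $D(ab)=a\cdot D(b)+D(a)\cdot b$; for $\xi,\eta\in Y$ put $\mathrm{ad}_{\xi,\eta}(a)=a\cdot\xi-\eta\cdot a$. A continuous derivation $D:C\to Y$ is approximately semi-inner if there are nets $(\xi_i),(\eta_i)$ in $Y$ with $D(a)=\lim_i\mathrm{ad}_{\xi_i,\eta_i}(a)$ in norm for all $a\in C$, and boundedly approximately semi-inner if moreover $\sup_i\|\mathrm{ad}_{\xi_i,\eta_i}\|<\infty$ (operator norm). $C$ is approximately semi-contractible (resp. boundedly approximately semi-contractible) if for every Banach $C$-bimodule $Y$ every continuous derivation $C\to Y$ is approximately semi-inner (resp. boundedly approximately semi-inner); $C$ is boundedly approximately semi-amenable if for every Banach $C$-bimodule $X$ every continuous derivation $C\to X^*$ is boundedly approximately semi-inner, where $X^*$ has the dual module structure $\langle a\cdot f,x\rangle=\langle f,x\cdot a\rangle$, $\langle f\cdot a,x\rangle=\langle f,a\cdot x\rangle$. With $C^{\#}$ the unitization (identity $e$), $C^{\#}\widehat{\otimes}C^{\#}$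 the projective tensor product and $\pi$ the product map, $K_{BASC}(C)$ is the infimum of all $K>0$ for which there are nets $(\xi_i),(\eta_i)$ in $C^{\#}\widehat{\otimes}C^{\#}$ with $a\cdot\xi_i-\eta_i\cdot a\to 0$ for all $a\in C$, $\|\mathrm{ad}_{\xi_i,\eta_i}\|\le K$ and $\pi(\xi_i)=\pi(\eta_i)=e$ for all $i$ ($+\infty$ if none). *)

(* Defs.v *)
From mathcomp Require Import all_boot all_algebra.
From mathcomp Require Import complex.
From mathcomp Require Import all_classical all_reals all_analysis.
Import numFieldNormedType.Exports.
Import GRing.Theory Num.Theory.

Set Implicit Arguments.
Unset Strict Implicit.
Unset Printing Implicit Defensive.

Local Open Scope ring_scope.

Section BanachAlgebraDefs.
Variable R : realType.
Local Notation C := (R[i]).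

Record banach_algebra (A : completeNormedModType C) (mul : A -> A -> A) : Prop := {
  ba_mulDl : forall a b c, mul (a + b) c = mul a c + mul b c;
  ba_mulDr : forall a b c, mul a (b + c) = mul a b + mul a c;
  ba_mulZl : forall (k : C) a b, mul (k *: a) b = k *: mul a b;
  ba_mulZr : forall (k : C) a b, mul a (k *: b) = k *: mul a b;
  ba_mulA : forall a b c, mul a (mul b c) = mul (mul a b) c;
  ba_normM : forall a b, `|mul a b| <= `|a| * `|b| }.

Definition lin (U V : normedModType C) (f : U -> V) : Prop :=
  (forall u v, f (u + v) = f u + f v) /\ (forall (k : C) u, f (k *: u) = k *: f u).

Definition alg_hom (A B : normedModType C) (mulA : A -> A -> A) (mulB : B -> B -> B)
  (f : A -> B) : Prop :=
  lin f /\ forall a b, f (mulA a b) = mulB (f a) (f b).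

Record bimodule (A : normedModType C) (mul : A -> A -> A) (Y : completeNormedModType C)
    (l : A -> Y -> Y) (r : Y -> A -> Y) : Prop := {
  bm_lDl : forall a b y, l (a + b) y = l a y + l b y;
  bm_lZl : forall (k : C) a y, l (k *: a) y = k *: l a y;
  bm_lDr : forall a y z, l a (y + z) = l a y + l a z;
  bm_lZr : forall (k : C) a y, l a (k *: y) = k *: l a y;
  bm_rDl : forall y z a, r (y + z) a = r y a + r z a;
  bm_rZl : forall (k : C) y a, r (k *: y) a = k *: r y a;
  bm_rDr : forall y a b, r y (a + b) = r y a + r y b;
  bm_rZr : forall (k : C) y a, r y (k *: a) = k *: r y a;
  bm_lA : forall a b y, l (mul a b) y = l a (l b y);
  bm_rA : forall y a b, r y (mul a b) = r (r y a) b;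
  bm_lr : forall a y b, l a (r y b) = r (l a y) b;
  bm_lbounded : exists M : C, forall a y, `|l a y| <= M * `|a| * `|y|;
  bm_rbounded : exists M : C, forall a y, `|r y a| <= M * `|a| * `|y| }.

Definition derivation (A : normedModType C) (mul : A -> A -> A) (Y : normedModType C)
    (l : A -> Y -> Y) (r : Y -> A -> Y) (D : A -> Y) : Prop :=
  lin D /\ forall a b, D (mul a b) = l a (D b) + r (D a) b.

Definition ad (A : normedModType C) (Y : normedModType C)
    (l : A -> Y -> Y) (r : Y -> A -> Y) (xi eta : Y) (a : A) : Y :=
  l a xi - r eta a.

Definition directed (I : Type) (le : I -> I -> Prop) : Prop :=
  [/\ (forall i, le i i), (forall i j k, le i j -> le j k -> le i k),
      inhabited I & (forall i j, exists k, le i k /\ le j k)].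

Definition net_to (I : Type) (le : I -> I -> Prop) (Y : normedModType C)
    (x : I -> Y) (y : Y) : Prop :=
  forall eps : C, 0 < eps -> exists i0, forall i, le i0 i -> `|x i - y| < eps.

Definition approx_semi_inner (A : normedModType C) (Y : normedModType C)
    (l : A -> Y -> Y) (r : Y -> A -> Y) (D : A -> Y) : Prop :=
  exists (I : Type) (le : I -> I -> Prop), directed le /\
  exists xi eta : I -> Y,
    forall a, net_to le (fun i => ad l r (xi i) (eta i) a) (D a).

Definition bdd_approx_semi_inner (A : normedModType C) (Y : normedModType C)
    (l : A -> Y -> Y) (r : Y -> A -> Y) (D : A -> Y) : Prop :=
  exists (I : Type) (le : I -> I -> Prop), directed le /\
  exists xi eta : I -> Y,
    (forall a, net_to le (fun i => ad l r (xi i) (eta i) a) (D a)) /\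
    exists M : C, forall i a, `|ad l r (xi i) (eta i) a| <= M * `|a|.

Definition approx_semi_contractible (A : completeNormedModType C) (mul : A -> A -> A) : Prop :=
  forall (Y : completeNormedModType C) (l : A -> Y -> Y) (r : Y -> A -> Y),
    bimodule mul l r ->
    forall D : A -> Y, derivation mul l r D -> continuous D -> approx_semi_inner l r D.

Definition bdd_approx_semi_contractible (A : completeNormedModType C) (mul : A -> A -> A) : Prop :=
  forall (Y : completeNormedModType C) (l : A -> Y -> Y) (r : Y -> A -> Y),
    bimodule mul l r ->
    forall D : A -> Y, derivation mul l r D -> continuous D -> bdd_approx_semi_inner l r D.

(* Dual bimodules X^*: elements are bounded linear functionals on X,   *)
(* A map into X^* is written A -> X -> C; all the notions above are    *)
(* unfolded for X^*.                                                   *)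
Definition dual_elt (X : normedModType C) (f : X -> C) : Prop :=
  (forall u v, f (u + v) = f u + f v) /\ (forall (k : C) u, f (k *: u) = k * f u) /\
  exists M : C, forall x, `|f x| <= M * `|x|.

Definition dual_l (A X : normedModType C) (r : X -> A -> X) (a : A) (f : X -> C) : X -> C :=
  fun x => f (r x a).
Definition dual_r (A X : normedModType C) (l : A -> X -> X) (f : X -> C) (a : A) : X -> C :=
  fun x => f (l a x).

Definition dual_cont_derivation (A : normedModType C) (mul : A -> A -> A) (X : normedModType C)
    (l : A -> X -> X) (r : X -> A -> X) (D : A -> X -> C) : Prop :=
  [/\ (forall a, dual_elt (D a)),
      (forall a b, D (a + b) = (fun x => D a x + D b x)),
      (forall (k : C) a, D (k *: a) = (fun x => k * D a x)),
      (forall a b, D (mul a b) = (fun x => dual_l r a (D b) x + dual_r l (D a) b x)) &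
      (* continuity into X^* with the dual norm (= boundedness) *)
      exists M : C, forall a x, `|D a x| <= M * `|a| * `|x| ].

Definition dual_ad (A X : normedModType C) (l : A -> X -> X) (r : X -> A -> X)
    (xi eta : X -> C) (a : A) : X -> C :=
  fun x => dual_l r a xi x - dual_r l eta a x.

Definition dual_bdd_approx_semi_inner (A X : normedModType C)
    (l : A -> X -> X) (r : X -> A -> X) (D : A -> X -> C) : Prop :=
  exists (I : Type) (le : I -> I -> Prop), directed le /\
  exists xi eta : I -> X -> C,
    (forall i, dual_elt (xi i) /\ dual_elt (eta i)) /\
    (* norm convergence in X^* : ||D a - ad_i a||_{X^*} -> 0 *)
    (forall a (eps : C), 0 < eps -> exists i0, forall i, le i0 i ->
        forall x, `|D a x - dual_ad l r (xi i) (eta i) a x| <= eps * `|x|) /\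
    exists M : C, forall i a x, `|dual_ad l r (xi i) (eta i) a x| <= M * `|a| * `|x|.

Definition bdd_approx_semi_amenable (A : completeNormedModType C) (mul : A -> A -> A) : Prop :=
  forall (X : completeNormedModType C) (l : A -> X -> X) (r : X -> A -> X),
    bimodule mul l r ->
    forall D : A -> X -> C, dual_cont_derivation mul l r D -> dual_bdd_approx_semi_inner l r D.

(* Unitization A^# = C x A, product (l,a)(m,b) = (lm, l b + m a + ab), *)
(* norm ||(l,a)|| = |l| + ||a||, identity e = (1,0).                   *)
Definition unitz (A : normedModType C) := (C * A)%type.

Definition uadd (A : normedModType C) (p q : unitz A) : unitz A := (p.1 + q.1, p.2 + q.2).
Definition uopp (A : normedModType C) (p : unitz A) : unitz A := (- p.1, - p.2).
Definition uscale (A : normedModType C) (k : C) (p : unitz A) : unitz A := (k * p.1, k *: p.2).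
Definition uzero (A : normedModType C) : unitz A := (0, 0).
Definition uunit (A : normedModType C) : unitz A := (1, 0).
Definition uinj (A : normedModType C) (a : A) : unitz A := (0, a).
Definition umul (A : normedModType C) (mul : A -> A -> A) (p q : unitz A) : unitz A :=
  (p.1 * q.1, p.1 *: q.2 + q.1 *: p.2 + mul p.2 q.2).
Definition unorm (A : normedModType C) (p : unitz A) : C := `|p.1| + `|p.2|.

(* Algebraic tensors: finite lists of pairs, sum_k x_k (x) y_k.         *)
Definition tens (A : normedModType C) := seq (unitz A * unitz A).

Definition bilinear_form (A : normedModType C) (beta : unitz A -> unitz A -> C) : Prop :=
  [/\ (forall p q s, beta (uadd p q) s = beta p s + beta q s),
      (forall k p s, beta (uscale k p) s = k * beta p s),
      (forall p q s, beta s (uadd p q) = beta s p + beta s q) &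
      (forall k p s, beta s (uscale k p) = k * beta s p)].

Definition teval (A : normedModType C) (beta : unitz A -> unitz A -> C) (t : tens A) : C :=
  \sum_(x <- t) beta x.1 x.2.

(* equality in the algebraic tensor product A^# (x) A^# *)
Definition tequiv (A : normedModType C) (t s : tens A) : Prop :=
  forall beta, bilinear_form beta -> teval beta t = teval beta s.

Definition tcost (A : normedModType C) (t : tens A) : C :=
  \sum_(x <- t) unorm x.1 * unorm x.2.

(* ||t||_pi <= c, where ||t||_pi = inf over representations of sum ||x_k|| ||y_k|| *)
Definition pnorm_le (A : normedModType C) (t : tens A) (c : C) : Prop :=
  forall eps : C, 0 < eps -> exists s, tequiv t s /\ tcost s < c + eps.

Definition tsub (A : normedModType C) (t s : tens A) : tens A :=
  t ++ map (fun x => (uopp x.1, x.2)) s.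
Definition tleft (A : normedModType C) (mul : A -> A -> A) (a : A) (t : tens A) : tens A :=
  map (fun x => (umul mul (uinj a) x.1, x.2)) t.
Definition tright (A : normedModType C) (mul : A -> A -> A) (t : tens A) (a : A) : tens A :=
  map (fun x => (x.1, umul mul x.2 (uinj a))) t.
Definition tpi (A : normedModType C) (mul : A -> A -> A) (t : tens A) : unitz A :=
  foldr (fun x acc => uadd (umul mul x.1 x.2) acc) (uzero A) t.

(* Completion: elements of A^# (x)^ A^# are represented by Cauchy       *)
(* sequences of algebraic tensors for the projective norm.             *)
Definition ptens (A : normedModType C) := nat -> tens A.

Definition ptens_cauchy (A : normedModType C) (u : ptens A) : Prop :=
  forall eps : C, 0 < eps -> exists N, forall m n, (N <= m)%N -> (N <= n)%N ->
    pnorm_le (tsub (u m) (u n)) eps.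

(* ||u|| <= c in the completion (||u|| = lim_m ||u m||_pi) *)
Definition ptnorm_le (A : normedModType C) (u : ptens A) (c : C) : Prop :=
  forall eps : C, 0 < eps -> exists N, forall m, (N <= m)%N -> pnorm_le (u m) (c + eps).

(* pi(u) = p, where pi is the continuous extension of the product map *)
Definition ptpi_eq (A : normedModType C) (mul : A -> A -> A) (u : ptens A) (p : unitz A) : Prop :=
  forall eps : C, 0 < eps -> exists N, forall m, (N <= m)%N ->
    unorm (uadd (tpi mul (u m)) (uopp p)) < eps.

Definition ptad (A : normedModType C) (mul : A -> A -> A) (xi eta : ptens A) (a : A) : ptens A :=
  fun m => tsub (tleft mul a (xi m)) (tright mul (eta m) a).

Definition basc_admissible (A : normedModType C) (mul : A -> A -> A) (K : R) : Prop :=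
  exists (I : Type) (le : I -> I -> Prop), directed le /\
  exists xi eta : I -> ptens A,
    [/\ (forall i, ptens_cauchy (xi i) /\ ptens_cauchy (eta i)),
        (forall a (eps : C), 0 < eps -> exists i0, forall i, le i0 i ->
           ptnorm_le (ptad mul (xi i) (eta i) a) eps),
        (forall i a, ptnorm_le (ptad mul (xi i) (eta i) a) (real_complex R K * `|a|)) &
        (forall i, ptpi_eq mul (xi i) (uunit A) /\ ptpi_eq mul (eta i) (uunit A))].

Definition K_BASC (A : normedModType C) (mul : A -> A -> A) : \bar R :=
  ereal_inf [set (K%:E)%E | K in [set K : R | 0 < K /\ basc_admissible mul K]].

(* Closed two-sided ideals, and "f is the quotient map A -> A/I"       *)
(* (up to isometric identification of B with A/I).                    *)
Definition closed_ideal (A : normedModType C) (mul : A -> A -> A) (I : set A) : Prop :=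
  [/\ I 0, (forall x y, I x -> I y -> I (x + y)), (forall (k : C) x, I x -> I (k *: x)),
      (forall a x, I x -> I (mul a x) /\ I (mul x a)) & closed I].

Definition is_quotient_map (A B : normedModType C) (I : set A) (f : A -> B) : Prop :=
  (forall a, f a = 0 <-> I a) /\
  (* ||f a|| = inf_{x in I} ||a + x||  (the quotient norm) *)
  forall a, (forall x, I x -> `|f a| <= `|a + x|) /\
    (forall eps : C, 0 < eps -> exists x, I x /\ `|a + x| < `|f a| + eps).

End BanachAlgebraDefs.

(* Main.v *)
Require Import Defs.
From mathcomp Require Import all_boot all_order all_algebra.
From mathcomp Require Import complex.
From mathcomp Require Import all_classical all_reals all_analysis.
From mathcomp Require Import ring lra.
Import numFieldNormedType.Exports.
Import GRing.Theory Num.Theory Order.TTheory.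

Set Implicit Arguments.
Unset Strict Implicit.
Unset Printing Implicit Defensive.
Local Open Scope classical_set_scope.
Local Open Scope complex_scope.
Local Open Scope ring_scope.

(** A Banach B-bimodule Y is an A-bimodule through Θ, and a continuous
    derivation D : B → Y gives the continuous derivation D ∘ Θ on A. Since Θ is
    onto, nets of maps ad_{ξ_i,η_i} approximating D ∘ Θ approximate D as well.
    Uniform bounds on ad_{ξ_i,η_i} survive because, by the open mapping
    theorem, every b lifts to some a with ‖a‖ ≤ c‖b‖. For K_BASC the nets of
    tensors are pushed forward along Θ ⊗ Θ, which is contractive on projective
    tensor products when Θ is a quotient map, and the quotient norm provides
    lifts with ‖a‖ ≤ ‖b‖ + ε, so an admissible constant K stays admissible. *)

Section ComplexNorm.
Variable R : realType.
Local Notation C := R[i].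

Lemma ge0_complexE (z : C) : 0 <= z -> z = (complex.Re z)%:C.
Proof. by case: z => a b; rewrite lecE /= => /andP[/eqP -> _]. Qed.

Lemma gt0_complexE (e : C) : 0 < e -> e = (complex.Re e)%:C /\ 0 < complex.Re e.
Proof.
by move=> e0; have e_eq := ge0_complexE (ltW e0); split; rewrite // -ltcR -e_eq.
Qed.

Lemma normc_real (r : R) : `|r%:C| = `|r|%:C.
Proof. by rewrite normc_def /= expr0n /= addr0 sqrtr_sqr. Qed.

(* Norms take values in [C], which is only partially ordered; estimates are
   carried out on their real parts, where [lra] applies. *)
Definition rnorm (X : normedModType C) (x : X) : R := complex.Re `|x|.

Section RNorm.
Variable X : normedModType C.

Lemma rnormE (x : X) : `|x| = (rnorm x)%:C.
Proof. exact: ge0_complexE. Qed.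

Lemma rnorm_ge0 (x : X) : 0 <= rnorm x.
Proof. by rewrite -ler0c -rnormE. Qed.

Lemma rnorm0 : rnorm (0 : X) = 0.
Proof. by rewrite /rnorm normr0. Qed.

Lemma rnormN (x : X) : rnorm (- x) = rnorm x.
Proof. by rewrite /rnorm normrN. Qed.

Lemma rnormD (x y : X) : rnorm (x + y) <= rnorm x + rnorm y.
Proof. by have := ler_normD x y; rewrite !rnormE -raddfD lecR. Qed.

Lemma rnormB (x y : X) : rnorm (x - y) <= rnorm x + rnorm y.
Proof. by have := rnormD x (- y); rewrite rnormN. Qed.

Lemma rnorm_eq0 (x : X) : rnorm x = 0 -> x = 0.
Proof. by move=> h; apply/normr0_eq0; rewrite rnormE h. Qed.

Lemma rnorm_gt0 (x : X) : x != 0 -> 0 < rnorm x.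
Proof.
move=> x_neq0; rewrite lt_def rnorm_ge0 andbT.
by apply: contra_neq x_neq0; apply: rnorm_eq0.
Qed.

Lemma rnormZ (r : R) (x : X) : rnorm (r%:C *: x) = `|r| * rnorm x.
Proof. by rewrite -[LHS]/(complex.Re `|r%:C *: x|) normrZ normc_real rnormE -rmorphM. Qed.

End RNorm.

Lemma rnorm_lecE (X Y : normedModType C) (x : X) (y : Y) (L : R) :
  (rnorm x <= L * rnorm y) = (`|x| <= L%:C * `|y|).
Proof. by rewrite !rnormE -rmorphM lecR. Qed.

Lemma exists_pow2_gt (k : R) : exists m : nat, k < 2 ^+ m.
Proof.
exists (Num.truncn k); apply: lt_le_trans (truncnS_gt k) _.
by rewrite -natrX ler_nat ltn_expl.
Qed.

Section Halving.
Variable X : normedModType C.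

Lemma rnorm_le_halving_eq0 (x : X) (K : R) :
  (forall m, rnorm x <= K / 2 ^+ m) -> x = 0.
Proof.
move=> hx; have [//|/rnorm_gt0 x_gt0] := eqVneq x 0.
have [m hm] := exists_pow2_gt (K / rnorm x).
rewrite ltr_pdivrMr // [2 ^+ m * _]mulrC -ltr_pdivrMr ?exprn_gt0 // in hm.
by have := le_lt_trans (hx m) hm; rewrite ltxx.
Qed.

Variables (x : nat -> X) (r : nat -> R).
Hypotheses (step_le : forall j, rnorm (x j.+1 - x j) <= r j)
  (r_halving : forall j, r j.+1 <= r j / 2).

Lemma halving_steps_dist m n : (m <= n)%N -> rnorm (x n - x m) <= 2 * r m.
Proof.
have r_ge0 j : 0 <= r j by apply: le_trans (step_le j); exact: rnorm_ge0.
suff tel k : rnorm (x (m + k)%N - x m) <= 2 * r m - 2 * r (m + k)%N.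
  move=> /subnKC <-; apply: le_trans (tel _) _; have := r_ge0 (m + (n - m))%N; lra.
elim: k => [|k IH]; first by rewrite addn0 subrr rnorm0 subrr.
rewrite addnS; have := rnormD (x (m + k).+1 - x (m + k)%N) (x (m + k)%N - x m).
rewrite addrA subrK => h; apply: le_trans h _.
have := step_le (m + k)%N; have := r_halving (m + k)%N; lra.
Qed.

Lemma halving_le m : r m <= r 0%N / 2 ^+ m.
Proof.
elim: m => [|m IH]; first by rewrite expr0 divr1.
rewrite exprSr invfM mulrA; have := r_halving m; lra.
Qed.

End Halving.

Lemma halving_steps_limit (X : completeNormedModType C) (x : nat -> X) (r : nat -> R) :
  (forall j, rnorm (x j.+1 - x j) <= r j) -> (forall j, r j.+1 <= r j / 2) ->
  exists xs : X, forall m, rnorm (xs - x m) <= 2 * r m.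
Proof.
move=> step_le r_halving.
have /cvg_ex[xs x_to_xs] : cvg (x @ \oo).
  apply: cauchy_cvg; apply: cauchy_exP => eps eps0.
  have [eps_eq e_gt0] := gt0_complexE eps0.
  have [m hm] := exists_pow2_gt (2 * r 0%N / complex.Re eps).
  exists (x m); apply: filterS (nbhs_infty_ge m) => n /= mn.
  rewrite -ball_normE /= distrC rnormE eps_eq ltcR.
  apply: le_lt_trans (halving_steps_dist step_le r_halving mn) _.
  rewrite ltr_pdivrMr // [2 ^+ m * _]mulrC -ltr_pdivrMr ?exprn_gt0 // in hm.
  have := halving_le r_halving m; rewrite -mulrA in hm; lra.
exists xs => m; rewrite leNgt; apply/negP => too_far.
set d := rnorm (xs - x m) - 2 * r m.
have d_gt0 : 0 < d%:C by rewrite ltcR subr_gt0.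
have /cvgr_dist_lt/(_ _ d_gt0) near_xs := x_to_xs.
near \oo => n.
have close : `|xs - x n| < d%:C by near: n.
have mn : (m <= n)%N by near: n; exact: nbhs_infty_ge.
rewrite rnormE ltcR in close.
have := halving_steps_dist step_le r_halving mn.
have := rnormD (xs - x n) (x n - x m); rewrite addrA subrK /d in close *; lra.
Unshelve. all: end_near.
Qed.

(* Nowhere density in the quantitative form used by the nested-ball argument;
   the factor [2] matches the bound of [halving_steps_limit]. *)
Definition nowhere_dense_in_balls (X : normedModType C) (S : set X) :=
  forall (y : X) (rho : R), 0 < rho -> exists (y' : X) (rho' : R),
    [/\ 0 < rho', rho' <= rho / 2, rnorm (y' - y) <= rho &
        forall z, rnorm (z - y') <= 2 * rho' -> ~ S z].

Lemma Baire_nowhere_dense (X : completeNormedModType C) (S : nat -> set X) :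
  (forall n, nowhere_dense_in_balls (S n)) -> exists z, forall n, ~ S n z.
Proof.
move=> S_nd.
have /choice[next next_ball] : forall p : nat * (X * R), exists q : X * R,
    0 < p.2.2 -> [/\ 0 < q.2, q.2 <= p.2.2 / 2, rnorm (q.1 - p.2.1) <= p.2.2 &
                     forall z, rnorm (z - q.1) <= 2 * q.2 -> ~ S p.1 z].
  move=> [n [y rho]] /=; have [rho_gt0|_] := ltP 0 rho.
    by have [y' [rho' ?]] := S_nd n y rho rho_gt0; exists (y', rho').
  by exists (y, rho).
pose fix balls k := if k is k'.+1 then next (k', balls k') else ((0 : X), (1 : R)).
have rad_gt0 k : 0 < (balls k).2.
  by elim: k => [|k IH] //=; have [] := next_ball (k, balls k) IH.
have [z z_in] : exists z : X, forall m, rnorm (z - (balls m).1) <= 2 * (balls m).2.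
  apply: halving_steps_limit => j /=.
  - by have [] := next_ball (j, balls j) (rad_gt0 j).
  - by have [] := next_ball (j, balls j) (rad_gt0 j).
exists z => n; have [_ _ _ avoid] := next_ball (n, balls n) (rad_gt0 n).
exact: avoid (z_in n.+1).
Qed.

Section Linear.
Variables (U V : normedModType C) (f : U -> V).
Hypothesis f_lin : lin f.

Lemma linD u v : f (u + v) = f u + f v. Proof. exact: f_lin.1. Qed.
Lemma linZ k u : f (k *: u) = k *: f u. Proof. exact: f_lin.2. Qed.

Lemma lin0 : f 0 = 0.
Proof. by have := linZ 0 0; rewrite !scale0r. Qed.

Lemma linN u : f (- u) = - f u.
Proof. by apply/eqP; rewrite -addr_eq0 -linD addNr lin0. Qed.

Lemma linB u v : f (u - v) = f u - f v.
Proof. by rewrite linD linN. Qed.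

Lemma lin_bounded : continuous f ->
  exists L : R, 0 < L /\ forall u, rnorm (f u) <= L * rnorm u.
Proof.
move=> f_cont; have /cvgr_dist_lt/(_ 1 ltr01)/nbhs_normP[e /= e_gt0 near0] := f_cont 0.
rewrite lin0 in near0; have [e_eq er_gt0] := gt0_complexE e_gt0.
exists (2 / complex.Re e); split=> [|u]; first by rewrite divr_gt0.
have [->|u_neq0] := eqVneq u 0; first by rewrite lin0 !rnorm0 mulr0.
have nu_gt0 := rnorm_gt0 u_neq0.
pose t := complex.Re e / (2 * rnorm u); have t_gt0 : 0 < t by rewrite divr_gt0 ?mulr_gt0.
have tu_small : ball_ Num.norm 0 e (t%:C *: u).
  rewrite /= sub0r normrN rnormE rnormZ (ger0_norm (ltW t_gt0)) e_eq ltcR /t.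
  rewrite invfM mulrA mulfVK ?gt_eqF //; lra.
have ftu_lt1 : t * rnorm (f u) < 1.
  rewrite -ltcR; have := near0 _ tu_small.
  by rewrite sub0r normrN linZ rnormE rnormZ (ger0_norm (ltW t_gt0)) => h; exact: h.
rewrite -(ler_pM2l t_gt0); apply: ltW; apply: lt_le_trans ftu_lt1 _.
by have -> : t * (2 / complex.Re e * rnorm u) = 1 by rewrite /t; field; rewrite ?gt_eqF //; lra.
Qed.

End Linear.

Section OpenMapping.
Variables (A B : completeNormedModType C) (f : A -> B).
Hypotheses (f_lin : lin f) (f_cont : continuous f) (f_onto : forall b, exists a, f a = b).

Lemma image_ball_dense_in_ball : exists (n : nat) (y0 : B) (rho : R), 0 < rho /\
  forall y, rnorm (y - y0) < rho -> forall eps : R, 0 < eps ->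
    exists a, rnorm a <= n%:R /\ rnorm (f a - y) < eps.
Proof.
apply: contrapT => no_dense_ball.
have nd n : nowhere_dense_in_balls [set f a | a in [set a | rnorm a <= n%:R]].
  move=> y0 rho rho_gt0.
  have [y [e [y_in e_gt0 far]]] : exists y (e : R), [/\ rnorm (y - y0) < rho, 0 < e &
      forall a, rnorm a <= n%:R -> e <= rnorm (f a - y)].
    apply: contrapT => no_far_point; apply: no_dense_ball; exists n, y0, rho.
    split=> // y y_in e e_gt0; apply: contrapT => no_close_image.
    apply: no_far_point; exists y, e; split => // a ha.
    by rewrite leNgt; apply/negP => close; apply: no_close_image; exists a.
  exists y, (Num.min (rho / 2) (e / 4)); split.
  - by rewrite lt_min !divr_gt0.
  - by rewrite ge_min lexx.
  - exact: ltW.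
  - move=> z z_near [a ha faz]; have := far a ha; rewrite faz.
    have : Num.min (rho / 2) (e / 4) <= e / 4 by rewrite ge_min lexx orbT.
    move: z_near; lra.
have [z z_out] := Baire_nowhere_dense nd.
have [a fa] := f_onto z.
apply: (z_out (Num.truncn (rnorm a)).+1); exists a => //=.
exact/ltW/truncnS_gt.
Qed.

(* Scale [y] to [y'] of norm [rho / 2] and take the difference of approximate
   preimages of [y0 + y'] and of [y0]. *)
Lemma approx_bounded_lift : exists c : R, 0 < c /\ forall y (eps : R), 0 < eps ->
  exists a, rnorm a <= c * rnorm y /\ rnorm (f a - y) < eps.
Proof.
have [n [y0 [rho [rho_gt0 dense]]]] := image_ball_dense_in_ball.
exists (4 * n.+1%:R / rho); split=> [|y eps eps_gt0].
  by rewrite divr_gt0 // mulr_gt0 // ltr0Sn.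
have [->|y_neq0] := eqVneq y 0; first by exists 0; rewrite lin0 // subr0 !rnorm0 mulr0.
have ny_gt0 := rnorm_gt0 y_neq0.
pose t := rho / (2 * rnorm y); have t_gt0 : 0 < t by rewrite divr_gt0 ?mulr_gt0.
pose y' := t%:C *: y.
have ny' : rnorm y' = rho / 2.
  by rewrite rnormZ (ger0_norm (ltW t_gt0)) /t; field; rewrite gt_eqF.
have teps_gt0 : 0 < t * eps / 2 by rewrite divr_gt0 // mulr_gt0.
have [|a1 [na1 fa1]] := dense (y0 + y') _ _ teps_gt0.
  by rewrite addrAC subrr add0r ny'; lra.
have [|a2 [na2 fa2]] := dense y0 _ _ teps_gt0; first by rewrite subrr rnorm0.
have ti_gt0 : 0 < t^-1 by rewrite invr_gt0.
exists (t^-1%:C *: (a1 - a2)); split.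
  rewrite rnormZ (ger0_norm (ltW ti_gt0)); have := rnormB a1 a2.
  have -> : 4 * n.+1%:R / rho * rnorm y = t^-1 * (2 * n.+1%:R).
    by rewrite /t; field; rewrite ?gt_eqF.
  by rewrite -natr1 ler_pM2l //; lra.
have y_eq : y = t^-1%:C *: y'.
  by rewrite /y' scalerA -rmorphM mulVf ?gt_eqF // rmorph1 scale1r.
rewrite linZ // linB // y_eq -scalerBr rnormZ (ger0_norm (ltW ti_gt0)).
have -> : f a1 - f a2 - y' = (f a1 - (y0 + y')) - (f a2 - y0).
  by rewrite opprD opprB !addrA (addrAC _ (- y')) subrK addrAC.
rewrite -(ltr_pM2l t_gt0) mulrA mulfV ?gt_eqF // mul1r.
have := rnormB (f a1 - (y0 + y')) (f a2 - y0); lra.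
Qed.

(* Successive approximation: [a k] lifts the remainder [z k] up to [z k.+1]. *)
Theorem open_mapping : exists c : R, 0 < c /\
  forall b, exists a, f a = b /\ rnorm a <= c * rnorm b.
Proof.
have [c [c_gt0 lift]] := approx_bounded_lift.
have [L [L_gt0 f_bd]] := lin_bounded f_lin f_cont.
exists (2 * c); split=> [|Y]; first by rewrite mulr_gt0.
have [->|Y_neq0] := eqVneq Y 0; first by exists 0; rewrite lin0 // !rnorm0 mulr0.
have nY_gt0 := rnorm_gt0 Y_neq0; set nY := rnorm Y in nY_gt0 *.
have /choice[g g_lift] : forall p : nat * B, exists a,
    rnorm a <= c * rnorm p.2 /\ rnorm (f a - p.2) < nY / 2 ^+ p.1.+1.
  by move=> [k z]; apply: lift; rewrite divr_gt0 // exprn_gt0.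
pose fix z k := if k is k'.+1 then z k' - f (g (k', z k')) else Y.
pose a k := g (k, z k).
pose fix S k := if k is k'.+1 then S k' + a k' else 0.
have z_le k : rnorm (z k) <= nY / 2 ^+ k.
  case: k => [|k] /=; first by rewrite expr0 divr1.
  by have [_ h] := g_lift (k, z k); rewrite -rnormN opprB; exact: ltW.
have a_le k : rnorm (a k) <= c * nY / 2 ^+ k.
  have [h _] := g_lift (k, z k); apply: le_trans h _.
  by rewrite -mulrA ler_wpM2l ?(ltW c_gt0) ?z_le.
have fS k : f (S k) = Y - z k.
  elim: k => [|k IH] /=; first by rewrite lin0 // subrr.
  by rewrite linD // IH opprB addrA addrAC.
have [Ss S_to] : exists Ss : A, forall m, rnorm (Ss - S m) <= 2 * (c * nY / 2 ^+ m).
  apply: halving_steps_limit => j /=; first by rewrite addrAC subrr add0r a_le.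
  by rewrite exprSr invfM mulrA.
exists Ss; split; last by have := S_to 0%N; rewrite /= subr0 expr0 divr1 mulrA.
apply/eqP; rewrite -subr_eq0; apply/eqP/(rnorm_le_halving_eq0 (K := (2 * L * c + 1) * nY)).
move=> m; have -> : f Ss - Y = f (Ss - S m) - z m.
  by rewrite linB // fS opprB addrA addrAC addrK.
apply: le_trans (rnormB _ _) _.
have -> : (2 * L * c + 1) * nY / 2 ^+ m = L * (2 * (c * nY / 2 ^+ m)) + nY / 2 ^+ m.
  by field; rewrite gt_eqF // exprn_gt0.
by apply: lerD (z_le m); apply: le_trans (f_bd _) _; rewrite ler_wpM2l ?(ltW L_gt0).
Qed.

End OpenMapping.

Lemma le_normr_coef (x M t : C) : 0 <= x -> x <= M * t -> 0 <= t -> x <= `|M| * t.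
Proof.
move=> x_ge0 x_le t_ge0; apply: le_trans (x_le) _.
by rewrite -{1}(ger0_norm (le_trans x_ge0 x_le)) normrM (ger0_norm t_ge0).
Qed.

Lemma le_lift_bound (A B : normedModType C) (Theta : A -> B) (c : R) (h : B -> C) (M : C) :
  (forall b, exists a, Theta a = b /\ rnorm a <= c * rnorm b) ->
  (forall b, 0 <= h b) -> (forall a, h (Theta a) <= M * `|a|) ->
  forall b, h b <= `|M| * c%:C * `|b|.
Proof.
move=> lift h_ge0 h_bd b; have [a [<- a_le]] := lift b.
apply: le_trans (le_normr_coef (h_ge0 _) (h_bd a) (normr_ge0 _)) _.
by rewrite -mulrA ler_wpM2l // -rnorm_lecE.
Qed.

Section Pullback.
Variables (A B : normedModType C) (mulA : A -> A -> A) (mulB : B -> B -> B) (Theta : A -> B).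
Hypotheses (Theta_hom : alg_hom mulA mulB Theta) (Theta_cont : continuous Theta).

Lemma bilinear_bound_pullback (Y Z : normedModType C) (k : B -> Y -> Z) (M : C) :
  (forall b y, `|k b y| <= M * `|b| * `|y|) ->
  exists M' : C, forall a y, `|k (Theta a) y| <= M' * `|a| * `|y|.
Proof.
move=> k_bd; have [L [_ Theta_bd]] := lin_bounded Theta_hom.1 Theta_cont.
exists (`|M| * L%:C) => a y.
have k_le : `|k (Theta a) y| <= `|M| * (`|Theta a| * `|y|).
  by apply: le_normr_coef; rewrite ?mulrA ?k_bd // mulr_ge0.
apply: le_trans k_le _; rewrite -!mulrA ler_wpM2l // mulrA ler_wpM2r //.
by rewrite -rnorm_lecE.
Qed.

Lemma bimodule_pullback (Y : completeNormedModType C) (l : B -> Y -> Y) (r : Y -> B -> Y) :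
  bimodule mulB l r -> bimodule mulA (fun a y => l (Theta a) y) (fun y a => r y (Theta a)).
Proof.
case: Theta_hom => Th_lin Th_mul.
case=> lDl lZl lDr lZr rDl rZl rDr rZr lA rA lr [M1 l_bd] [M2 r_bd]; split.
- by move=> a b y; rewrite linD // lDl.
- by move=> k a y; rewrite linZ // lZl.
- by move=> a y z; rewrite lDr.
- by move=> k a y; rewrite lZr.
- by move=> y z a; rewrite rDl.
- by move=> k y a; rewrite rZl.
- by move=> y a b; rewrite linD // rDr.
- by move=> k y a; rewrite linZ // rZr.
- by move=> a b y; rewrite Th_mul lA.
- by move=> y a b; rewrite Th_mul rA.
- by move=> a y b; rewrite lr.
- exact: bilinear_bound_pullback l_bd.
- exact: (bilinear_bound_pullback (k := fun b y => r y b)) r_bd.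
Qed.

Lemma derivation_pullback (Y : normedModType C) (l : B -> Y -> Y) (r : Y -> B -> Y)
    (D : B -> Y) :
  derivation mulB l r D ->
  derivation mulA (fun a y => l (Theta a) y) (fun y a => r y (Theta a)) (fun a => D (Theta a)).
Proof.
case: Theta_hom => Th_lin Th_mul [D_lin D_mul]; split; first split.
- by move=> u v; rewrite !linD.
- by move=> k u; rewrite !linZ.
- by move=> a b; rewrite Th_mul D_mul.
Qed.

Lemma dual_cont_derivation_pullback (X : normedModType C) (l : B -> X -> X)
    (r : X -> B -> X) (D : B -> X -> C) :
  dual_cont_derivation mulB l r D ->
  dual_cont_derivation mulA (fun a x => l (Theta a) x) (fun x a => r x (Theta a))
    (fun a => D (Theta a)).
Proof.
case: Theta_hom => Th_lin Th_mul [D_dual DD DZ DM [M D_bd]]; split.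
- by move=> a; exact: D_dual.
- by move=> a b; rewrite linD // DD.
- by move=> k a; rewrite linZ // DZ.
- by move=> a b; rewrite Th_mul DM.
- exact: (@bilinear_bound_pullback X C^o D M D_bd).
Qed.

End Pullback.

Section SurjectiveImage.
Variables (A B : completeNormedModType C) (mulA : A -> A -> A) (mulB : B -> B -> B).
Variable Theta : A -> B.
Hypotheses (Theta_hom : alg_hom mulA mulB Theta) (Theta_cont : continuous Theta)
  (Theta_onto : forall b, exists a, Theta a = b).

Lemma continuous_pullback (Y : normedModType C) (D : B -> Y) :
  continuous D -> continuous (fun a => D (Theta a)).
Proof. by move=> D_cont a; apply: continuous_comp; [exact: Theta_cont | exact: D_cont]. Qed.

Lemma approx_semi_contractible_image :
  approx_semi_contractible mulA -> approx_semi_contractible mulB.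
Proof.
move=> A_asc Y l r Y_bimod D D_der D_cont.
have [I [le [le_dir [xi [eta ad_to]]]]] :=
  A_asc Y _ _ (bimodule_pullback Theta_hom Theta_cont Y_bimod) _
    (derivation_pullback Theta_hom D_der) (continuous_pullback D_cont).
exists I, le; split => //; exists xi, eta => b.
by have [a <-] := Theta_onto b; exact: ad_to.
Qed.

Lemma bdd_approx_semi_contractible_image :
  bdd_approx_semi_contractible mulA -> bdd_approx_semi_contractible mulB.
Proof.
move=> A_basc Y l r Y_bimod D D_der D_cont.
have [c [_ c_lift]] := open_mapping Theta_hom.1 Theta_cont Theta_onto.
have [I [le [le_dir [xi [eta [ad_to [M M_bd]]]]]]] :=
  A_basc Y _ _ (bimodule_pullback Theta_hom Theta_cont Y_bimod) _
    (derivation_pullback Theta_hom D_der) (continuous_pullback D_cont).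
exists I, le; split => //; exists xi, eta; split.
  by move=> b; have [a <-] := Theta_onto b; exact: ad_to.
exists (`|M| * c%:C) => i.
exact: (le_lift_bound (h := fun b => `|ad l r (xi i) (eta i) b|) c_lift
  (fun _ => normr_ge0 _) (M_bd i)).
Qed.

Lemma bdd_approx_semi_amenable_image :
  bdd_approx_semi_amenable mulA -> bdd_approx_semi_amenable mulB.
Proof.
move=> A_basa X l r X_bimod D D_der.
have [c [_ c_lift]] := open_mapping Theta_hom.1 Theta_cont Theta_onto.
have [I [le [le_dir [xi [eta [xi_eta_dual [ad_to [M M_bd]]]]]]]] :=
  A_basa X _ _ (bimodule_pullback Theta_hom Theta_cont X_bimod) _
    (dual_cont_derivation_pullback Theta_hom Theta_cont D_der).
exists I, le; split => //; exists xi, eta; do 2!split => //.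
  by move=> b eps eps_gt0; have [a <-] := Theta_onto b; exact: ad_to.
exists (`|M| * c%:C) => i b x.
have := le_lift_bound (h := fun b => `|dual_ad l r (xi i) (eta i) b x|) (M := M * `|x|)
  c_lift (fun _ => normr_ge0 _) _ b.
have -> : `|M * `|x| | * c%:C * `|b| = `|M| * c%:C * `|b| * `|x|.
  by rewrite normrM normr_id; ring.
by apply; move=> a; rewrite mulrAC; exact: M_bd.
Qed.

End SurjectiveImage.

Lemma pnorm_le_mono (A : normedModType C) (t : tens A) (c c' : C) :
  pnorm_le t c -> c <= c' -> pnorm_le t c'.
Proof.
move=> t_le c_le eps eps_gt0; have [s [ts s_cost]] := t_le eps eps_gt0.
by exists s; split => //; apply: lt_le_trans s_cost _; rewrite lerD2r.
Qed.

Section TensorPushforward.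
Variables (A B : normedModType C) (mulA : A -> A -> A) (mulB : B -> B -> B).
Variable Theta : A -> B.
Hypotheses (Theta_hom : alg_hom mulA mulB Theta) (Theta_contr : forall a, `|Theta a| <= `|a|).

Definition umap (p : unitz A) : unitz B := (p.1, Theta p.2).
Definition tmap (t : tens A) : tens B := map (fun x => (umap x.1, umap x.2)) t.

Lemma umapD p q : umap (uadd p q) = uadd (umap p) (umap q).
Proof. by rewrite /umap /uadd /= (linD Theta_hom.1). Qed.

Lemma umapZ k p : umap (uscale k p) = uscale k (umap p).
Proof. by rewrite /umap /uscale /= (linZ Theta_hom.1). Qed.

Lemma umapN p : umap (uopp p) = uopp (umap p).
Proof. by rewrite /umap /uopp /= (linN Theta_hom.1). Qed.

Lemma umap0 : umap (uzero A) = uzero B.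
Proof. by rewrite /umap /uzero /= (lin0 Theta_hom.1). Qed.

Lemma umap1 : umap (uunit A) = uunit B.
Proof. by rewrite /umap /uunit /= (lin0 Theta_hom.1). Qed.

Lemma umapM p q : umap (umul mulA p q) = umul mulB (umap p) (umap q).
Proof.
case: Theta_hom => Th_lin Th_mul.
by rewrite /umap /umul /= !(linD Th_lin) !(linZ Th_lin) Th_mul.
Qed.

Lemma unorm_ge0 (X : normedModType C) (p : unitz X) : 0 <= unorm p.
Proof. by rewrite addr_ge0. Qed.

Lemma unorm_umap p : unorm (umap p) <= unorm p.
Proof. by rewrite /unorm lerD2l Theta_contr. Qed.

(* Bilinear forms on the unitization of [B] pull back along [umap]. *)
Lemma tequiv_map t s : tequiv t s -> tequiv (tmap t) (tmap s).
Proof.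
move=> ts beta [bDl bZl bDr bZr].
have := ts (fun p q => beta (umap p) (umap q)); rewrite /teval /tmap !big_map; apply.
split=> [p q x|k p x|p q x|k p x]; by rewrite ?umapD ?umapZ ?bDl ?bZl ?bDr ?bZr.
Qed.

Lemma tcost_map t : tcost (tmap t) <= tcost t.
Proof.
rewrite /tcost /tmap big_map; apply: ler_sum => x _ /=.
by apply: ler_pM; rewrite ?unorm_ge0 ?unorm_umap.
Qed.

Lemma pnorm_le_map t c : pnorm_le t c -> pnorm_le (tmap t) c.
Proof.
move=> t_le eps eps_gt0; have [s [ts s_cost]] := t_le eps eps_gt0.
by exists (tmap s); split; [exact: tequiv_map | exact: le_lt_trans (tcost_map s) s_cost].
Qed.

Lemma tmap_sub t s : tmap (tsub t s) = tsub (tmap t) (tmap s).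
Proof.
rewrite /tmap /tsub map_cat -!map_comp; congr (_ ++ _).
by apply: eq_map => x /=; rewrite umapN.
Qed.

Lemma tmap_left a t : tmap (tleft mulA a t) = tleft mulB (Theta a) (tmap t).
Proof. by rewrite /tmap /tleft -!map_comp; apply: eq_map => x /=; rewrite umapM. Qed.

Lemma tmap_right a t : tmap (tright mulA t a) = tright mulB (tmap t) (Theta a).
Proof. by rewrite /tmap /tright -!map_comp; apply: eq_map => x /=; rewrite umapM. Qed.

Lemma tpi_map t : tpi mulB (tmap t) = umap (tpi mulA t).
Proof. by elim: t => [|x t IH] /=; rewrite ?umap0 // IH umapD umapM. Qed.

Lemma ptad_map (u v : ptens A) a :
  ptad mulB (fun m => tmap (u m)) (fun m => tmap (v m)) (Theta a) =
  fun m => tmap (ptad mulA u v a m).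
Proof. by apply: funext => m; rewrite /ptad tmap_sub tmap_left tmap_right. Qed.

Lemma ptnorm_le_map (u : ptens A) c : ptnorm_le u c -> ptnorm_le (fun m => tmap (u m)) c.
Proof.
move=> u_le eps eps_gt0; have [N u_le_N] := u_le eps eps_gt0.
by exists N => m /u_le_N; exact: pnorm_le_map.
Qed.

Lemma ptens_cauchy_map (u : ptens A) : ptens_cauchy u -> ptens_cauchy (fun m => tmap (u m)).
Proof.
move=> u_cauchy eps eps_gt0; have [N u_N] := u_cauchy eps eps_gt0.
by exists N => m n Nm Nn; rewrite -tmap_sub; exact: pnorm_le_map (u_N m n Nm Nn).
Qed.

Lemma ptpi_map (u : ptens A) :
  ptpi_eq mulA u (uunit A) -> ptpi_eq mulB (fun m => tmap (u m)) (uunit B).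
Proof.
move=> u_pi eps eps_gt0; have [N u_pi_N] := u_pi eps eps_gt0.
exists N => m Nm; rewrite tpi_map -umap1 -umapN -umapD.
exact: le_lt_trans (unorm_umap _) (u_pi_N m Nm).
Qed.

End TensorPushforward.

Section QuotientMap.
Variables (A B : normedModType C) (mulA : A -> A -> A) (mulB : B -> B -> B).
Variables (Theta : A -> B) (I : set A).
Hypotheses (Theta_hom : alg_hom mulA mulB Theta) (Theta_onto : forall b, exists a, Theta a = b)
  (I_ideal : closed_ideal mulA I) (Theta_quot : is_quotient_map I Theta).

Lemma quotient_map_contractive a : `|Theta a| <= `|a|.
Proof. by have := (Theta_quot.2 a).1 0; rewrite addr0; apply; case: I_ideal. Qed.

Lemma quotient_map_lift b (eps : C) : 0 < eps -> exists a, Theta a = b /\ `|a| < `|b| + eps.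
Proof.
move=> eps_gt0; have [a0 <-] := Theta_onto b.
have [x [Ix a0x_lt]] := (Theta_quot.2 a0).2 _ eps_gt0.
by exists (a0 + x); rewrite (linD Theta_hom.1) (Theta_quot.1 x).2 // addr0.
Qed.

(* A net admissible for [K] is pushed forward; the bound [K |b|] is obtained
   from a lift [a] of [b] with [K |a| <= K |b| + eps / 2]. *)
Lemma basc_admissible_quotient K : 0 < K -> basc_admissible mulA K -> basc_admissible mulB K.
Proof.
case: (Theta_hom) => Th_lin Th_mul K_gt0.
move=> [J [le [le_dir [xi [eta [xi_eta_cauchy ad_to ad_bd pi_e]]]]]].
have Theta_contr := quotient_map_contractive.
exists J, le; split => //.
exists (fun i m => tmap Theta (xi i m)), (fun i m => tmap Theta (eta i m)); split.
- by move=> i; have [? ?] := xi_eta_cauchy i; split; apply: ptens_cauchy_map.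
- move=> b eps eps_gt0; have [a <-] := Theta_onto b; have [i0 ad_small] := ad_to a eps eps_gt0.
  by exists i0 => i /ad_small; rewrite (ptad_map Theta_hom); exact: ptnorm_le_map.
- move=> i b eps eps_gt0; have [eps_eq e_gt0] := gt0_complexE eps_gt0.
  have [|a [<- a_lt]] := quotient_map_lift b (eps := (complex.Re eps / (2 * K))%:C).
    by rewrite ltcR divr_gt0 ?mulr_gt0.
  have e2_gt0 : 0 < (complex.Re eps / 2)%:C by rewrite ltcR divr_gt0.
  have ad_le : ptnorm_le (ptad mulB (fun m => tmap Theta (xi i m))
      (fun m => tmap Theta (eta i m)) (Theta a)) (K%:C * `|a|).
    by rewrite (ptad_map Theta_hom); exact: ptnorm_le_map (ad_bd i a).
  have [N ad_le_N] := ad_le _ e2_gt0.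
  exists N => m Nm; apply: pnorm_le_mono (ad_le_N m Nm) _.
  rewrite eps_eq !rnormE -!rmorphM -!rmorphD lecR.
  rewrite !rnormE -rmorphD ltcR in a_lt.
  have := ler_wpM2l (ltW K_gt0) (ltW a_lt).
  have -> : K * (rnorm (Theta a) + complex.Re eps / (2 * K)) =
    K * rnorm (Theta a) + complex.Re eps / 2 by field; rewrite gt_eqF.
  lra.
- by move=> i; have [? ?] := pi_e i; split; apply: ptpi_map.
Qed.

Lemma K_BASC_quotient_le : (K_BASC mulB <= K_BASC mulA)%E.
Proof.
apply: ereal_inf_le_tmp => _ [K [K_gt0 K_adm] <-]; exists K => //; split => //.
exact: basc_admissible_quotient.
Qed.

End QuotientMap.
End ComplexNorm.

Theorem proposition3p11 (R : realType) (A B : completeNormedModType R[i])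
  (mulA : A -> A -> A) (mulB : B -> B -> B)
  (hA : banach_algebra mulA) (hB : banach_algebra mulB)
  (Theta : A -> B) (hTh : alg_hom mulA mulB Theta) (cTh : continuous Theta)
  (sTh : forall b : B, exists a : A, Theta a = b) :
  (approx_semi_contractible mulA -> approx_semi_contractible mulB) /\
  (bdd_approx_semi_contractible mulA ->
     bdd_approx_semi_contractible mulB /\
     (forall I : set A, closed_ideal mulA I -> is_quotient_map I Theta ->
        (K_BASC mulB <= K_BASC mulA)%E)) /\
  (bdd_approx_semi_amenable mulA -> bdd_approx_semi_amenable mulB).
Proof.
split; first exact: approx_semi_contractible_image hTh cTh sTh.
split; last exact: bdd_approx_semi_amenable_image hTh cTh sTh.
move=> A_basc; split; first exact: bdd_approx_semi_contractible_image hTh cTh sTh A_basc.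
by move=> I I_ideal Theta_quot; exact: K_BASC_quotient_le hTh sTh I_ideal Theta_quot.
Qed.
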